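(* Let $m\ge 7$, $X=\mathbb{F}_{2^m}\setminus\{0,1\}$, and let $W_2,W_7$ be as in the context. Then the triple $(X,W_2,W_7)$ is a $\mathrm{GDD}(2^m-2,2,7)$ with balance parameter $\lambda_7=\frac{(2^m-8)(2^m-16)(2^m-32)(2^m-64)}{5!}$.
   Context: $\mathbb{F}_{2^m}$ is the finite field with $2^m$ elements, with zero $0$ and unity $1$; all sums are in $\mathbb{F}_{2^m}$. For each integer $k\ge 2$, $W_k=\{B\subset X : |B|=k,\ \sum_{i\in B} i=1,\ \text{and } \binom{B}{\ell}\cap W_\ell=\emptyset \text{ for all } 2\le \ell\le k-3\}$ (recursive definition; $\binom{B}{\ell}$ is the set of $\ell$-subsets of $B$). A group divisible design $\mathrm{GDD}(v,n,k)$ is a triple $(X,\mathcal{G},\mathcal{B})$ where $X$ is a $v$-set, $\mathcal{G}$ is a collection of $n$-subsets of $X$ (groups) and $\mathcal{B}$ is a collection of $k$-subsets of $X$ (blocks), such that (i) $\mathcal{G}$ is a partition of $X$; (ii) no two elements of a block lie together in a common group; (iii) every pair of distinct elements of $X$ from different groups occurs together in exactly $\lambda$ blocks; $\lambda$ is called the balance parameter. *)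

(* Defs.v *)
From HB Require Import structures.
From mathcomp Require Export all_boot all_order all_algebra.

Set Implicit Arguments.
Unset Strict Implicit.
Unset Printing Implicit Defensive.

Import GRing.Theory.
Local Open Scope nat_scope.

Section SubsetFamilies.
Variable T : finType.
Implicit Types (X B C G : {set T}) (GG BB : {set {set T}}).

Definition ksubsets B l : {set {set T}} :=
  [set C : {set T} | (C \subset B) && (#|C| == l)].

Record is_GDD (v n k lambda : nat) X GG BB : Prop := IsGDD {
  GDD_points : #|X| = v;
  GDD_groups : GG \subset ksubsets X n;
  GDD_blocks : BB \subset ksubsets X k;
  GDD_partition : partition GG X;
  GDD_transverse : forall B G x y, B \in BB -> G \in GG ->
    x \in B -> y \in B -> x != y -> ~ (x \in G /\ y \in G);
  GDD_balance : forall G1 G2 x y, G1 \in GG -> G2 \in GG -> G1 != G2 ->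
    x \in G1 -> y \in G2 -> x != y ->
    #|[set B in BB | (x \in B) && (y \in B)]| = lambda
}.

End SubsetFamilies.

Section ZeroSumFamilies.
Variable F : finFieldType.

Definition Xset : {set F} := [set x | (x != 0%R) && (x != 1%R)].

(* [W_rec fuel k] is the k-th family whenever fuel > k; see [WE] for the
   defining recurrence. The side condition l <= k - 3 is written l + 3 <= k,
   so that no l satisfies it when k < 3. *)
Fixpoint W_rec (fuel k : nat) : {set {set F}} :=
  if fuel is fuel'.+1 then
    [set B in ksubsets Xset k | (\sum_(i in B) i == 1)%R &&
      [forall l : 'I_k, (2 <= l) && (l + 3 <= k) ==>
        (ksubsets B l :&: W_rec fuel' l == set0)]]
  else set0.

Definition W (k : nat) : {set {set F}} := W_rec k.+1 k.

Lemma W_rec_fuel f1 f2 k : k < f1 -> k < f2 -> W_rec f1 k = W_rec f2 k.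
Proof.
elim: f1 f2 k => [|f1 IH] [|f2] k //= kf1 kf2.
apply/setP=> B; rewrite !inE; congr (_ && (_ && _)).
by apply: eq_forallb => l; rewrite (IH f2) // (leq_trans (ltn_ord l)).
Qed.

Lemma WE k (B : {set F}) :
  B \in W k <->
  [/\ B \subset Xset, #|B| = k, (\sum_(i in B) i)%R = 1%R &
      forall l, 2 <= l -> l + 3 <= k -> ksubsets B l :&: W l = set0].
Proof.
rewrite /W /= !inE; split.
  case/andP=> /andP[BX /eqP cB] /andP[/eqP sB /forallP h]; split=> // l l2 lk.
  have lk' : l < k by apply: leq_trans lk; rewrite addn3 ltnS ltnW.
  move: (h (Ordinal lk')); rewrite /= l2 lk /= => /eqP.
  by rewrite (@W_rec_fuel k l.+1).
case=> -> -> -> h; rewrite !eqxx /=; apply/forallP=> l; apply/implyP.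
by case/andP=> l2 lk; rewrite (@W_rec_fuel k l.+1) // h.
Qed.

End ZeroSumFamilies.

(* Main.v *)
(** The conditions defining [W 7] say exactly that [1] together with any six
    elements of a block is linearly independent over the two-element field,
    the seventh element being the sum of these seven vectors.  Fix two points
    [x], [y] of different groups and count the independent sets containing
    [1, x, y]: an independent [k]-set spans [2 ^ k] vectors, so it has
    [2 ^ m - 2 ^ k] independent extensions by one vector, and double counting
    the flags goes from size 3 to size 7.  A last double count of pairs
    (block, distinguished element other than [x], [y]) accounts for the
    factor 5. *)

Require Import Defs.
From mathcomp Require Import all_boot all_order all_algebra.
From mathcomp Require Import finfield zify ring.

Set Implicit Arguments.
Unset Strict Implicit.
Unset Printing Implicit Defensive.

Import GRing.Theory.
Local Open Scope nat_scope.

(** * Double counting of flags *)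

Lemma card_dep_pairs (T U : finType) (P : {set T}) (Q : T -> {set U}) n :
  (forall a, a \in P -> #|Q a| = n) ->
  #|[set p : T * U | (p.1 \in P) && (p.2 \in Q p.1)]| = #|P| * n.
Proof.
move=> hQ; rewrite -sum1_card.
rewrite (eq_bigl (fun p : T * U => (p.1 \in P) && (p.2 \in Q p.1))); last first.
  by move=> p; rewrite inE.
rewrite -(pair_big_dep (mem P) (fun a => mem (Q a)) (fun _ _ => 1)) /=.
by rewrite -sum_nat_const; apply: eq_bigr => a aP; rewrite sum1_card; apply: hQ.
Qed.

(** The maps [(a, z) -> (f a z, z)] and [(b, z) -> (g b z, z)] are mutually inverse bijections
    between the two sets of flags. Keeping [z] on both sides is what makes the passage
    reversible. *)
Lemma double_count (T1 T2 U : finType)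
    (P1 : {set T1}) (Q1 : T1 -> {set U}) n1
    (P2 : {set T2}) (Q2 : T2 -> {set U}) n2
    (f : T1 -> U -> T2) (g : T2 -> U -> T1) :
  (forall a, a \in P1 -> #|Q1 a| = n1) ->
  (forall b, b \in P2 -> #|Q2 b| = n2) ->
  (forall a z, a \in P1 -> z \in Q1 a ->
    [/\ f a z \in P2, z \in Q2 (f a z) & g (f a z) z = a]) ->
  (forall b z, b \in P2 -> z \in Q2 b ->
    [/\ g b z \in P1, z \in Q1 (g b z) & f (g b z) z = b]) ->
  #|P1| * n1 = #|P2| * n2.
Proof.
move=> h1 h2 hf hg; rewrite -(card_dep_pairs h1) -(card_dep_pairs h2).
set S1 := [set p | _]; set S2 := [set p | _].
pose F p := (f p.1 p.2, p.2).
have inS1 p : p \in S1 -> p.1 \in P1 /\ p.2 \in Q1 p.1.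
  by rewrite inE => /andP.
rewrite -(@card_in_imset _ _ F); last first.
  move=> [a z] [a' z'] /inS1[/= aP zQ] /inS1[/= a'P z'Q] [e ez].
  have [_ _ <-] := hf _ _ aP zQ; have [_ _ <-] := hf _ _ a'P z'Q.
  by rewrite e ez.
congr #|pred_of_set _|; apply/setP=> -[b z]; apply/imsetP/idP.
  case=> -[a z'] /inS1[/= aP zQ] [-> ->]; rewrite inE /=.
  by have [-> ->] := hf _ _ aP zQ.
rewrite inE /= => /andP[bP zQ]; have [aP zQ1 e] := hg _ _ bP zQ.
by exists (g b z, z); rewrite ?inE /= ?aP // /F /= e.
Qed.

(** * Subset sums and independence in characteristic 2 *)

Section BinaryIndependence.
Variable F : finFieldType.
Hypothesis char2 : 2 \in [pchar F]%R.
Implicit Types (A B C D G T : {set F}) (x y z : F).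

Definition setsum A : F := (\sum_(i in A) i)%R.

(* Linear independence over the two-element prime field. *)
Definition indep A :=
  [forall C : {set F}, (C \subset A) && (C != set0) ==> (setsum C != 0%R)].

Definition binary_span A : {set F} := setsum @: powerset A.

Definition indep_ext T k : {set {set F}} :=
  [set A : {set F} | [&& T \subset A, #|A| == k & indep A]].

Lemma indepP A :
  reflect (forall C, C \subset A -> setsum C = 0%R -> C = set0) (indep A).
Proof.
apply: (iffP forallP) => h C.
  move=> CA s0; apply/eqP/negPn/negP => C0.
  by move: (h C); rewrite CA C0 s0 eqxx.
by apply/implyP => /andP[CA]; apply: contraNN => /eqP /(h _ CA) ->.
Qed.

Lemma indep_subset A B : A \subset B -> indep B -> indep A.
Proof.
move=> AB /indepP iB; apply/indepP => C CA; apply: iB.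
exact: subset_trans AB.
Qed.

Lemma setsum0 : setsum set0 = 0%R.
Proof. exact: big_set0. Qed.

Lemma setsum1 x : setsum [set x] = x.
Proof. exact: big_set1. Qed.

Lemma setsumU1 x A : x \notin A -> setsum (x |: A) = (x + setsum A)%R.
Proof. exact: big_setU1. Qed.

Lemma setsumD1 x A : x \in A -> setsum (A :\ x) = (x + setsum A)%R.
Proof.
by move=> xA; rewrite /setsum (big_setD1 x xA) /= addrA addrr_pchar2 ?add0r.
Qed.

Lemma setsumD A B : A \subset B -> setsum (B :\: A) = (setsum A + setsum B)%R.
Proof.
move=> /setIidPr e; rewrite /setsum (big_setID A (A := B)) /= e.
by rewrite addrA addrr_pchar2 ?add0r.
Qed.

Lemma addr_eq_pchar2 x y z : (x + y = z -> x = z + y)%R.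
Proof. by move=> <-; rewrite -addrA addrr_pchar2 ?addr0. Qed.

Lemma addr_eq0_pchar2 x y : (x + y = 0 -> x = y)%R.
Proof. by move=> /addr_eq_pchar2; rewrite add0r. Qed.

Lemma setsum_symdiff A B :
  setsum ((A :\: B) :|: (B :\: A)) = (setsum A + setsum B)%R.
Proof.
have dAB : [disjoint A :\: B & B :\: A].
  rewrite -setI_eq0; apply/eqP/setP=> x; rewrite !inE.
  by case: (x \in A); rewrite ?andbF.
rewrite /setsum (big_setID B (A := A)) (big_setID A (A := B)) /= (setIC B A).
rewrite (eq_bigl [predU (A :\: B) & (B :\: A)]); last by move=> x; rewrite !inE.
by rewrite bigU //= addrACA addrr_pchar2 ?add0r.
Qed.

(** Equal sums give the symmetric difference sum zero, and an independent set has no nonempty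
    zero-sum subset. *)
Lemma setsum_inj A : indep A -> {in powerset A &, injective setsum}.
Proof.
move=> /indepP iA C D; rewrite !powersetE => CA DA e.
have /setP d0 : (C :\: D) :|: (D :\: C) = set0.
  apply: iA; last by rewrite setsum_symdiff e addrr_pchar2.
  by rewrite subUset !(subset_trans (subsetDl _ _)).
by apply/setP=> x; move: (d0 x); rewrite !inE; case: (x \in C); case: (x \in D).
Qed.

Lemma card_binary_span A : indep A -> #|binary_span A| = 2 ^ #|A|.
Proof. by move=> /setsum_inj /card_in_imset ->; rewrite card_powerset. Qed.

(** A zero-sum subset of [z |: A] through [z] writes [z] as the sum of its other elements. The
    conjunct [z \notin A] matters: for [z] in [A] the set [z |: A] is [A] itself, still
    independent. *)
Lemma indep_setU1 z A :
  indep A -> (z \notin A) && indep (z |: A) = (z \notin binary_span A).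
Proof.
move=> iA; apply/andP/idP.
  move=> [zA /indepP iz]; apply/imsetP=> -[C]; rewrite powersetE => CA ez.
  have zC : z \notin C by apply: contraNN zA => /(subsetP CA).
  have : z |: C = set0.
    by apply: iz; [rewrite setUS | rewrite setsumU1 // -ez addrr_pchar2].
  by move/setP/(_ z); rewrite !inE eqxx.
move=> zS; split.
  apply: contraNN zS => zA; apply/imsetP; exists [set z].
    by rewrite powersetE sub1set.
  by rewrite setsum1.
apply/indepP => C CzA sC; have [zC|zC] := boolP (z \in C).
  case/negP: zS; apply/imsetP; exists (C :\ z); first by rewrite powersetE subDset.
  by rewrite setsumD1 // sC addr0.
move/indepP: iA; apply=> //; apply/subsetP => x xC.
move/subsetP/(_ x xC): CzA; rewrite !inE => /orP[/eqP e|//].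
by rewrite -e xC in zC.
Qed.

Lemma binary_span0 : binary_span set0 = [set 0%R].
Proof. by rewrite /binary_span powerset0 imset_set1 setsum0. Qed.

Lemma binary_spanU1 x y A :
  y \in binary_span (x |: A) -> y \in binary_span A \/ (x + y)%R \in binary_span A.
Proof.
case/imsetP=> C; rewrite powersetE => CxA ->; have [xC|xC] := boolP (x \in C).
  right; apply/imsetP; exists (C :\ x); last by rewrite setsumD1.
  by rewrite powersetE subDset.
left; apply/imsetP; exists C => //; rewrite powersetE.
apply/subsetP => u uC; move/subsetP/(_ u uC): CxA; rewrite !inE => /orP[/eqP e|//].
by rewrite -e uC in xC.
Qed.

(** The triple is built one vector at a time: the hypotheses exclude [x] from the span {0, 1} and
    [y] from the span {0, 1, x, x + 1}. *)
Lemma indep_triple x y :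
  x \in Xset F -> y \in Xset F -> x != y -> y != (x + 1)%R ->
  indep [set 1%R; x; y] /\ #|[set 1%R; x; y]| = 3.
Proof.
rewrite !inE => /andP[x0 x1] /andP[y0 y1] xy yx1.
have i0 : indep set0 by apply/indepP => C; rewrite subset0 => /eqP.
have s1 : 1%R \notin binary_span set0 by rewrite binary_span0 inE oner_neq0.
move: (s1); rewrite -indep_setU1 // => /andP[_ i1].
have s2 : x \notin binary_span (1%R |: set0).
  apply/negP => /binary_spanU1; rewrite binary_span0 !inE (negPf x0).
  by case=> // /eqP /addr_eq0_pchar2 e; rewrite e eqxx in x1.
move: (s2); rewrite -indep_setU1 // => /andP[n2 i2].
have s3 : y \notin binary_span (x |: (1%R |: set0)).
  apply/negP => /binary_spanU1 [] /binary_spanU1; rewrite binary_span0 !inE.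
    rewrite (negPf y0).
    by case=> // /eqP /addr_eq0_pchar2 e; rewrite e eqxx in y1.
  case=> /eqP => [/addr_eq0_pchar2 e|]; first by rewrite e eqxx in xy.
  by rewrite addrA => /addr_eq0_pchar2 e; rewrite -e addrC eqxx in yx1.
move: (s3); rewrite -indep_setU1 // => /andP[n3 i3].
have -> : [set 1%R; x; y] = y |: (x |: (1%R |: set0)).
  by rewrite setU0 [RHS]setUC (setUC [set x]).
by split=> //; rewrite cardsU1 n3 cardsU1 n2 setU0 cards1.
Qed.

(** * Counting independent sets that contain a given one *)

Lemma indep_ext_base T : indep T -> #|indep_ext T #|T| | = 1.
Proof.
move=> iT; rewrite -[RHS](cards1 T); congr #|pred_of_set _|.
apply/setP=> A; rewrite !inE; apply/and3P/eqP => [[TA /eqP cA _]|->] //.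
by apply/esym/eqP; rewrite eqEcard TA cA leqnn.
Qed.

(** Both sides count a [k.+1]-set with a marked element [z] outside [T]: adding [z] needs it outside
    the span of the [k]-set, and any element outside [T] can be removed. *)
Lemma indep_extS T k :
  #|indep_ext T k| * (#|F| - 2 ^ k) = #|indep_ext T k.+1| * (k.+1 - #|T|).
Proof.
pose Q1 A := ~: binary_span A; pose Q2 A := A :\: T.
apply: (@double_count _ _ _ _ Q1 _ _ Q2 _ (fun A z => z |: A) (fun A z => A :\ z)).
- move=> A; rewrite inE => /and3P[_ /eqP <- iA].
  by rewrite cardsCs setCK card_binary_span.
- by move=> A; rewrite inE => /and3P[TA /eqP <- _]; rewrite cardsD (setIidPr TA).
- move=> A z; rewrite !inE => /and3P[TA /eqP cA iA].
  rewrite -indep_setU1 // => /andP[zA izA].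
  rewrite cardsU1 zA cA izA eqxx eqxx (subset_trans TA) ?subsetUr //= setU1K //.
  by split=> //; rewrite andbT; apply: contraNN zA; apply/subsetP.
- move=> A z; rewrite !inE => /and3P[TA /eqP cA iA] /andP[zT zA].
  have iAz : indep (A :\ z) by apply: indep_subset iA; apply: subD1set.
  rewrite -indep_setU1 // setD1K // !inE eqxx iA iAz.
  move: cA; rewrite (cardsD1 z) zA add1n => -[->].
  by rewrite eqxx subsetD1 TA zT.
Qed.

(** The extension steps from size 3 to size 7 start from [T] alone; their multiplicities 1, 2, 3, 4
    multiply to [4!]. *)
Lemma card_indep_ext7 T : indep T -> #|T| = 3 ->
  #|indep_ext T 7| * 4`! =
  (#|F| - 8) * (#|F| - 16) * (#|F| - 32) * (#|F| - 64).
Proof.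
move=> iT cT.
have b := indep_ext_base iT; rewrite cT in b.
have := indep_extS T 3; have := indep_extS T 4.
have := indep_extS T 5; have := indep_extS T 6; rewrite cT b.
rewrite (_ : 4`! = 24) //.
rewrite (_ : 2 ^ 3 = 8) // (_ : 2 ^ 4 = 16) // (_ : 2 ^ 5 = 32) // (_ : 2 ^ 6 = 64) //.
rewrite (_ : 4 - 3 = 1) // (_ : 5 - 3 = 2) // (_ : 6 - 3 = 3) // (_ : 7 - 3 = 4) //.
rewrite mul1n muln1 => e6 e5 e4 ->.
by rewrite e4 [_ * 2 * _]mulnAC e5 -mulnA [2 * _]mulnC mulnA [_ * 3 * _]mulnAC e6; ring.
Qed.

(** * Blocks of [W F 7] and independent 7-sets containing 1 *)

Lemma W_smallE l C : l <= 4 ->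
  (C \in W F l) = [&& C \subset Xset F, #|C| == l & setsum C == 1%R].
Proof.
move=> l4; apply/idP/and3P.
  by move=> /WE[-> -> e _]; rewrite eqxx /setsum e.
case=> CX /eqP cC /eqP sC; apply/WE; split=> // k k2 kl.
(* A forbidden size [k] satisfies [2 <= k] and [k + 3 <= l], which needs [l >= 5]. *)
by lia.
Qed.

(** Sizes 2 to 4 are excluded by the definition of [W], sizes 0 and 1 because 1 is neither 0 nor in
    [Xset F]. For sizes 5 and 6 the complement in [B] has sum zero, so it would be two equal
    elements or the element 0. *)
Lemma W7_setsum_neq1 B C : B \in W F 7 -> C \proper B -> setsum C != 1%R.
Proof.
move=> /WE[BX cB sB hB] pC; rewrite -/(setsum B) in sB; have CB := proper_sub pC.
have CX := subset_trans CB BX.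
have C7 : #|C| < 7 by rewrite -cB proper_card.
have cD : #|B :\: C| = 7 - #|C| by rewrite cardsD (setIidPr CB) cB.
apply/eqP => sC.
have sD : setsum (B :\: C) = 0%R by rewrite setsumD // sC sB addrr_pchar2.
have [l24|] := boolP (2 <= #|C| <= 4).
  have /andP[l2 l4] := l24.
  have l7 : #|C| + 3 <= 7 by lia.
  have /setP/(_ C) := hB _ l2 l7.
  by rewrite in_setI in_set0 W_smallE // inE CB CX sC !eqxx.
rewrite negb_and -!ltnNge => hC.
have : [\/ #|C| = 0, #|C| = 1, #|B :\: C| = 2 | #|B :\: C| = 1].
  rewrite cD; move: hC C7; case: #|C| => [|[|[|[|[|[|[|n]]]]]]] // _ _;
    by [constructor 1|constructor 2|constructor 3|constructor 4].
case=> /eqP.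
- by rewrite cards_eq0 => /eqP C0; move/eqP: sC; rewrite C0 setsum0 eq_sym oner_eq0.
- case/cards1P=> x Cx; move: CX; rewrite Cx sub1set !inE -sC Cx setsum1 eqxx.
  by rewrite andbF.
- case/cards2P=> x [y [xy DE]]; move: sD.
  rewrite DE setsumU1 ?inE // setsum1 => /addr_eq0_pchar2 e.
  by rewrite e eqxx in xy.
- case/cards1P=> x Dx; have : x \in B :\: C by rewrite Dx inE.
  rewrite inE => /andP[_ /(subsetP BX)].
  by move: sD; rewrite Dx setsum1 => ->; rewrite !inE eqxx.
Qed.

(** Since [B] sums to 1, the complement of a nonempty zero-sum [C] would be a proper subset with sum
    1. *)
Lemma W7_setsum_neq0 B C :
  B \in W F 7 -> C \proper B -> setsum C = 0%R -> C = set0.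
Proof.
move=> BW pC sC; apply/eqP/negPn/negP => C0; have CB := proper_sub pC.
have : B :\: C \proper B.
  rewrite properE subsetDl /=; apply/negP => /subsetP h.
  by case/set0Pn: C0 => x xC; move: (h x (subsetP CB x xC)); rewrite inE xC.
move=> /(W7_setsum_neq1 BW); rewrite setsumD // sC add0r.
by case/WE: BW => _ _; rewrite /setsum => ->; rewrite eqxx.
Qed.

Lemma W7_indep B z : B \in W F 7 -> z \in B -> indep (1%R |: (B :\ z)).
Proof.
move=> BW zB; apply/indepP => C CA sC.
have pC D : D \subset B :\ z -> D \proper B.
  by move=> DB; apply: sub_proper_trans DB (properD1 zB).
have [C1|C1] := boolP (1%R \in C).
  have /(W7_setsum_neq1 BW) : C :\ 1%R \proper B by apply: pC; rewrite subDset.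
  by rewrite setsumD1 // sC addr0 eqxx.
apply: (W7_setsum_neq0 BW) => //; apply: pC; apply/subsetP => u uC.
move/subsetP/(_ u uC): CA; rewrite in_setU1 => /orP[/eqP e|//].
by rewrite -e uC in C1.
Qed.

(** Converse of [W7_indep]: exchanging 1 for [s = setsum A] gives the total [s + (1 + s) = 1]. *)
Lemma indep_W7 A : indep A -> #|A| = 7 -> 1%R \in A ->
  setsum A \notin A /\ setsum A |: (A :\ 1%R) \in W F 7.
Proof.
move=> /indepP iA cA A1; set s := setsum A.
have cA1 : #|A :\ 1%R| = 6 by move: cA; rewrite (cardsD1 1%R) A1 add1n => -[].
have sAz z : z \in A -> s != z.
  move=> zA; apply/eqP => e.
  have : A :\ z = set0 by apply: iA; rewrite ?subD1set // setsumD1 // -/s e addrr_pchar2.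
  move/(congr1 (fun E : {set F} => #|E|)); move: cA.
  by rewrite (cardsD1 z) zA cards0 add1n => -[->].
have sA : s \notin A by apply/negP => /sAz; rewrite eqxx.
have sA1 : s \notin A :\ 1%R by rewrite inE (negPf sA) andbF.
split=> //; apply/WE; split.
- apply/subsetP => u; rewrite !inE => /orP[/eqP ->|/andP[u1 uA]].
    rewrite (sAz 1%R) // andbT; apply/eqP => /(iA _ (subxx _)) A0.
    by rewrite A0 cards0 in cA.
  rewrite u1 andbT; apply/eqP => u0.
  have : [set u] = set0 by apply: iA; rewrite ?sub1set // setsum1.
  by move/setP/(_ u); rewrite !inE eqxx.
- by rewrite cardsU1 sA1 cA1.
- rewrite -/(setsum _) setsumU1 // setsumD1 // -/s addrC -addrA.
  by rewrite addrr_pchar2 ?addr0.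
- move=> l l2 l7; apply/setP => C; rewrite in_setI in_set0 W_smallE; last by lia.
  apply/negP; rewrite inE => /andP[/andP[CB /eqP cC]].
  case/and3P=> _ _ /eqP sC; have [sinC|snC] := boolP (s \in C).
    (* Both [A :\ 1] and [C :\ s] sum to [1 + s], so their difference has sum zero and is empty; but
       [C :\ s] has at most 3 elements and cannot cover 6. *)
    have CA1 : C :\ s \subset A :\ 1%R by rewrite subDset.
    have : (A :\ 1%R) :\: (C :\ s) = set0.
      apply: iA; first by rewrite (subset_trans (subsetDl _ _)) ?subD1set.
      rewrite setsumD // !setsumD1 // sC -/s (addrC s).
      by rewrite addrr_pchar2.
    move/eqP; rewrite setD_eq0 => /subset_leq_card; rewrite cA1.
    by move: cC; rewrite (cardsD1 s) sinC; lia.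
  have CA1 : C \subset A :\ 1%R.
    apply/subsetP => u uC; move/subsetP/(_ u uC): CB.
    by rewrite in_setU1 => /orP[/eqP e|//]; rewrite -e uC in snC.
  have C1 : 1%R \notin C by apply/negP => /(subsetP CA1); rewrite !inE eqxx.
  have : 1%R |: C = set0.
    apply: iA; last by rewrite setsumU1 // sC addrr_pchar2.
    by rewrite subUset sub1set A1 (subset_trans CA1) ?subD1set.
  by move/setP/(_ 1%R); rewrite !inE eqxx.
Qed.

(** A block with one of its 5 points [z] other than [x], [y] corresponds to the set [A] obtained by
    exchanging [z] for 1. Nothing is lost, since [setsum A = 1 + (z + 1) = z]. *)
Lemma card_W7_pair x y : x \in Xset F -> y \in Xset F -> x != y ->
  #|[set B in W F 7 | (x \in B) && (y \in B)]| * 5 =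
  #|indep_ext [set 1%R; x; y] 7|.
Proof.
move=> xX yX xy; rewrite -[RHS]muln1.
have [x1 y1] : x != 1%R /\ y != 1%R.
  by move: xX yX; rewrite !inE => /andP[_ ->] /andP[_ ->].
(* The singleton [Q2 A] accounts for the factor 1 introduced by [muln1]. *)
pose Q1 B := B :\: [set x; y]; pose Q2 A := [set setsum A].
apply: (@double_count _ _ _ _ Q1 _ _ Q2 _
  (fun B z => 1%R |: (B :\ z)) (fun A z => z |: (A :\ 1%R))).
- move=> B; rewrite inE => /and3P[/WE[_ cB _ _] xB yB].
  rewrite cardsD cB (setIidPr _) ?cards2 ?xy //.
  by rewrite subUset !sub1set xB.
- by move=> A _; rewrite cards1.
- move=> B z; rewrite inE => /and3P[BW xB yB]; rewrite !inE => /andP[zxy zB].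
  have iA := W7_indep BW zB.
  case/WE: BW => BX cB sB _.
  have B1 : 1%R \notin B by apply/negP => /(subsetP BX); rewrite !inE eqxx andbF.
  have Bz1 : 1%R \notin B :\ z by rewrite inE (negPf B1) andbF.
  have cBz : #|B :\ z| = 6 by move: cB; rewrite (cardsD1 z) zB add1n => -[].
  move: zxy; rewrite negb_or ![z == _]eq_sym => /andP[zx zy].
  split.
  + rewrite iA cardsU1 Bz1 cBz eqxx !subUset !sub1set !inE eqxx xB yB zx zy.
    by rewrite !orbT.
  + rewrite setsumU1 // setsumD1 // /setsum sB addrCA addrr_pchar2 // addr0.
    by rewrite eqxx.
  + by rewrite setU1K // setD1K.
- move=> A z; rewrite inE => /and3P[]; rewrite !subUset !sub1set.
  case/andP=> /andP[A1 xA] yA /eqP cA iA; rewrite inE => /eqP ->.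
  have [sA AW] := indep_W7 iA cA A1.
  have sA1 : setsum A \notin A :\ 1%R by rewrite inE (negPf sA) andbF.
  split.
  + by rewrite inE AW /= !inE xA yA x1 y1 !orbT.
  + by rewrite !inE eqxx andbT negb_or; apply/andP; split;
      apply: contraNneq sA => ->.
  + by rewrite setU1K // setD1K.
Qed.

Lemma card_W7_pair_formula x y :
  x \in Xset F -> y \in Xset F -> x != y -> y != (x + 1)%R ->
  #|[set B in W F 7 | (x \in B) && (y \in B)]| * 5`! =
  (#|F| - 8) * (#|F| - 16) * (#|F| - 32) * (#|F| - 64).
Proof.
move=> xX yX xy yx1; have [iT cT] := indep_triple xX yX xy yx1.
by rewrite -(card_indep_ext7 iT cT) -card_W7_pair // -mulnA.
Qed.

(** * Groups as the orbits of translation by 1 *)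

Lemma addr1_neq x : x != (x + 1)%R.
Proof. by rewrite -[X in X != _]addr0 (inj_eq (addrI x)) eq_sym oner_neq0. Qed.

Lemma addr1_Xset x : x \in Xset F -> (x + 1)%R \in Xset F.
Proof.
rewrite !inE => /andP[x0 x1]; apply/andP; split; apply/eqP.
  by move/addr_eq0_pchar2 => e; rewrite e eqxx in x1.
by move/addr_eq_pchar2; rewrite addrr_pchar2 // => e; rewrite e eqxx in x0.
Qed.

Lemma W2_addr1 x : x \in Xset F -> [set x; (x + 1)%R] \in W F 2.
Proof.
move=> xX; rewrite W_smallE // subUset !sub1set xX addr1_Xset // cards2.
rewrite addr1_neq setsumU1 ?inE ?addr1_neq // setsum1.
by rewrite addrA addrr_pchar2 // add0r !eqxx.
Qed.

Lemma W2_mem G x : G \in W F 2 -> x \in G -> G = [set x; (x + 1)%R].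
Proof.
rewrite W_smallE // => /and3P[_ cG /eqP sG] xG.
have : #|G :\ x| == 1 by move: cG; rewrite (cardsD1 x) xG add1n eqSS.
case/cards1P=> y Gy; have := setsumD1 xG.
by rewrite sG Gy setsum1 => <-; rewrite -Gy setD1K.
Qed.

Lemma W2_partition : partition (W F 2) (Xset F).
Proof.
apply/and3P; split.
- rewrite eqEsubset; apply/andP; split.
    by apply/bigcupsP => G; rewrite W_smallE // => /and3P[].
  apply/subsetP => x xX; apply/bigcupP; exists [set x; (x + 1)%R].
    exact: W2_addr1.
  by rewrite !inE eqxx.
- apply/trivIsetP => G1 G2 W1 W2; apply: contraNT.
  case/pred0Pn => x /andP[/= x1 x2].
  by rewrite (W2_mem W1 x1) (W2_mem W2 x2).
- by rewrite W_smallE // cards0 andbF.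
Qed.

Lemma card_Xset : #|Xset F| = #|F| - 2.
Proof.
have -> : Xset F = ~: [set 0%R; 1%R] by apply/setP => x; rewrite !inE negb_or.
by rewrite cardsCs setCK cards2 eq_sym oner_neq0.
Qed.

Lemma W_sub_ksubsets k : W F k \subset ksubsets (Xset F) k.
Proof. by apply/subsetP => B /WE[BX cB _ _]; rewrite inE BX cB eqxx. Qed.

(** A group meeting [B] in two points lies inside [B], yet 2 is among the sizes forbidden in the
    definition of [W F 7]. *)
Lemma W7_transverse B G x y : B \in W F 7 -> G \in W F 2 ->
  x \in B -> y \in B -> x != y -> ~ (x \in G /\ y \in G).
Proof.
move=> BW GW xB yB xy [xG yG].
have GB : G \subset B.
  rewrite (W2_mem GW xG) in yG *; move: yG; rewrite !inE eq_sym (negPf xy) /=.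
  by move/eqP => <-; rewrite subUset !sub1set xB.
case/WE: BW => _ _ _ /(_ 2 isT isT) /setP/(_ G).
by rewrite in_setI in_set0 GW inE GB; case/WE: GW => _ -> _ _.
Qed.

(** * Assembling the design and its balance parameter *)

Lemma W7_GDD lambda :
  lambda * 5`! = (#|F| - 8) * (#|F| - 16) * (#|F| - 32) * (#|F| - 64) ->
  is_GDD (#|F| - 2) 2 7 lambda (Xset F) (W F 2) (W F 7).
Proof.
move=> hl; split.
- exact: card_Xset.
- exact: W_sub_ksubsets.
- exact: W_sub_ksubsets.
- exact: W2_partition.
- exact: W7_transverse.
move=> G1 G2 x y W1 W2 G12 x1 y2 xy.
have inX G z : G \in W F 2 -> z \in G -> z \in Xset F.
  by move=> /WE[GX _ _ _]; apply/subsetP.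
have xX := inX _ _ W1 x1; have yX := inX _ _ W2 y2.
(* If [y = x + 1], both groups would be the pair {x, x + 1}. *)
have yx1 : y != (x + 1)%R.
  apply: contraNneq G12 => e; rewrite (W2_mem W1 x1) (W2_mem W2 y2) e.
  by rewrite -addrA addrr_pchar2 // addr0 setUC.
apply/eqP; rewrite -(eqn_pmul2r (fact_gt0 5)) hl.
by rewrite card_W7_pair_formula.
Qed.

(** Divisibility by [5!] comes from the count itself: the quotient is the number of blocks through
    an actual pair. With 5 field elements [Xset F] has at least 3 points, so one lies outside {x, x
    + 1}. *)
Lemma exists_W7_balance : 5 <= #|F| -> exists lambda,
  lambda * 5`! = (#|F| - 8) * (#|F| - 16) * (#|F| - 32) * (#|F| - 64).
Proof.
move=> hF.
have /set0Pn[x xX] : Xset F != set0 by rewrite -card_gt0 card_Xset; lia.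
have /set0Pn[y] : Xset F :\: [set x; (x + 1)%R] != set0.
  rewrite -card_gt0 cardsD card_Xset subn_gt0.
  have := subset_leq_card (subsetIr (Xset F) [set x; (x + 1)%R]).
  by rewrite cards2; lia.
rewrite !in_setD in_set2 negb_or eq_sym => /andP[/andP[xy yx1] yX].
by exists #|[set B in W F 7 | (x \in B) && (y \in B)]|; apply: card_W7_pair_formula.
Qed.

End BinaryIndependence.

Theorem theorem3p19 (m : nat) (hm : 7 <= m) (F : finFieldType)
    (hF : #|F| = 2 ^ m) :
  exists lambda7 : nat,
    (lambda7%:R = ((2 ^+ m - 8) * (2 ^+ m - 16)
                   * (2 ^+ m - 32) * (2 ^+ m - 64)) / (5`!)%:R :> rat)%R
    /\ is_GDD (2 ^ m - 2) 2 7 lambda7 (Xset F) (W F 2) (W F 7).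
Proof.
have char2 : 2 \in [pchar F]%R by apply: card_finPcharP hF _.
have q128 : 2 ^ 7 <= 2 ^ m by rewrite leq_exp2l.
have [|l hl] := exists_W7_balance char2.
  by rewrite hF; apply: leq_trans q128.
exists l; split; last by rewrite -hF; apply: W7_GDD.
apply: (canRL (mulfK _)); first by rewrite Num.Theory.pnatr_eq0.
(* As [2 ^ m >= 128], none of the natural subtractions truncates, so they agree with the rational
   ones. *)
rewrite -natrM hl hF !natrM !natrB ?natrX //; exact: leq_trans q128.
Qed.
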